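(* Let $\iota_k: B_k\to A_k$ be an algebra homomorphism for each $k=1,\dots,n$. Let $B=B_1\times\cdots\times B_n$, $A=A_1\times\cdots\times A_n$, and let $B\to A$ be the homomorphism $\iota=\iota_1\times\cdots\times\iota_n$. Then $A\mid B$ is D2 if and only if $A_k\mid B_k$ is D2 for each $k=1,\dots,n$.
   Context: Algebras are unital, associative (not necessarily commutative) over a commutative ground ring $K$, and algebra homomorphisms are unit-preserving. An algebra extension $A\mid B$ is a unit-preserving algebra homomorphism $B\to A$. $X\oplus *\cong Y$ means $X$ is isomorphic to a direct summand of $Y$. $A\mid B$ is left D2 (respectively right D2) if $A\otimes_BA\oplus *\cong A^N$ for some positive integer $N$ as $B$-$A$-bimodules (respectively $A$-$B$-bimodules); it is D2 if it is both left and right D2. *)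

(* Defs.v *)
From HB Require Import structures.
From mathcomp Require Import all_boot all_order all_algebra.
From mathcomp Require Import ring_quotient boolp.
From mathcomp.multinomials Require Import freeg.

Set Implicit Arguments.
Unset Strict Implicit.
Unset Printing Implicit Defensive.

Import GRing.Theory.
Import Quotient.

Local Open Scope ring_scope.
Local Open Scope quotient_scope.

#[local] Obligation Tactic := idtac.

(* [algType] is built on [nzRingType] and so excludes the zero algebra, which
   is a legitimate unital algebra (possibly one of the factors of a product).
   Hence a K-algebra is given here as a possibly zero ring together with a ring
   morphism from K to its centre; [algebra_of_algType] is the comparison. *)
Record algebra (K : comPzRingType) := MkAlgebra {
  algebra_sort :> pzRingType;
  alg_const : {rmorphism K -> algebra_sort};
  alg_constC : forall (k : K) (x : algebra_sort),
    alg_const k * x = x * alg_const k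
}.

Arguments alg_const {K A} : rename.

Program Definition algebra_of_algType (K : comPzRingType) (A : algType K) :
    algebra K :=
  @MkAlgebra K A (in_alg A) _.
Next Obligation. by move=> * /=; rewrite /= mulr_algl mulr_algr. Qed.

Record alg_morphism (K : comPzRingType) (A B : algebra K) := AlgMorphism {
  alg_morphism_fun :> {rmorphism A -> B};
  alg_morphism_const : forall k : K,
    alg_morphism_fun (alg_const k) = alg_const k
}.

Section Product.
Variables (K : comPzRingType) (n : nat) (A : 'I_n -> algebra K).

Definition prodRing := {dffun forall k : 'I_n, A k}.

HB.instance Definition _ := Choice.on prodRing.

Implicit Types x y z : prodRing.

Let zero : prodRing := [ffun k => 0 : A k].
Let opp x : prodRing := [ffun k => - x k : A k].
Let add x y : prodRing := [ffun k => x k + y k : A k].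

Fact prodRing_addA : associative add.
Proof. by move=> x y z; apply/ffunP => k; rewrite !ffunE addrA. Qed.
Fact prodRing_addC : commutative add.
Proof. by move=> x y; apply/ffunP => k; rewrite !ffunE addrC. Qed.
Fact prodRing_add0 : left_id zero add.
Proof. by move=> x; apply/ffunP => k; rewrite !ffunE add0r. Qed.
Fact prodRing_addN : left_inverse zero opp add.
Proof. by move=> x; apply/ffunP => k; rewrite !ffunE addNr. Qed.

HB.instance Definition _ := GRing.isZmodule.Build prodRing
  prodRing_addA prodRing_addC prodRing_add0 prodRing_addN.

Let one : prodRing := [ffun k => 1 : A k].
Let mul x y : prodRing := [ffun k => x k * y k : A k].

Fact prodRing_mulA : associative mul.
Proof. by move=> x y z; apply/ffunP => k; rewrite !ffunE mulrA. Qed.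
Fact prodRing_mul1 : left_id one mul.
Proof. by move=> x; apply/ffunP => k; rewrite !ffunE mul1r. Qed.
Fact prodRing_1mul : right_id one mul.
Proof. by move=> x; apply/ffunP => k; rewrite !ffunE mulr1. Qed.
Fact prodRing_mulDl : left_distributive mul +%R.
Proof. by move=> x y z; apply/ffunP => k; rewrite !ffunE mulrDl. Qed.
Fact prodRing_mulDr : right_distributive mul +%R.
Proof. by move=> x y z; apply/ffunP => k; rewrite !ffunE mulrDr. Qed.

HB.instance Definition _ := GRing.Zmodule_isPzRing.Build prodRing
  prodRing_mulA prodRing_mul1 prodRing_1mul prodRing_mulDl prodRing_mulDr.

Let const (c : K) : prodRing := [ffun k => alg_const c : A k].

Fact prodRing_const_zmod_morphism : zmod_morphism const.
Proof. by move=> c d; apply/ffunP => k; rewrite !ffunE raddfB. Qed.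
Fact prodRing_const_monoid_morphism : monoid_morphism const.
Proof.
by split=> [|c d]; apply/ffunP => k; rewrite !ffunE (rmorph1, rmorphM).
Qed.

HB.instance Definition _ := GRing.isZmodMorphism.Build K prodRing const
  prodRing_const_zmod_morphism.
HB.instance Definition _ := GRing.isMonoidMorphism.Build K prodRing const
  prodRing_const_monoid_morphism.

Fact prodRing_constC (c : K) x : const c * x = x * const c.
Proof. by apply/ffunP => k; rewrite !ffunE alg_constC. Qed.

Definition prodAlg : algebra K := @MkAlgebra K prodRing const prodRing_constC.

End Product.

Section ProductMorphism.
Variables (K : comPzRingType) (n : nat) (B A : 'I_n -> algebra K).
Variable iota : forall k, alg_morphism (B k) (A k).

Definition prodAlg_fun (x : prodAlg B) : prodAlg A :=
  [ffun k => iota k (x k) : A k].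

Fact prodAlg_fun_zmod_morphism : zmod_morphism prodAlg_fun.
Proof. by move=> x y; apply/ffunP => k; rewrite !ffunE raddfB. Qed.
Fact prodAlg_fun_monoid_morphism : monoid_morphism prodAlg_fun.
Proof.
by split=> [|x y]; apply/ffunP => k; rewrite !ffunE (rmorph1, rmorphM).
Qed.

HB.instance Definition _ := GRing.isZmodMorphism.Build _ _ prodAlg_fun
  prodAlg_fun_zmod_morphism.
HB.instance Definition _ := GRing.isMonoidMorphism.Build _ _ prodAlg_fun
  prodAlg_fun_monoid_morphism.

Fact prodAlg_fun_const (k : K) : prodAlg_fun (alg_const k) = alg_const k.
Proof. by apply/ffunP => i; rewrite !ffunE alg_morphism_const. Qed.

Definition prodAlg_morphism : alg_morphism (prodAlg B) (prodAlg A) :=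
  @AlgMorphism K (prodAlg B) (prodAlg A) prodAlg_fun prodAlg_fun_const.

End ProductMorphism.

(* As usual for bimodules over K-algebras, the two induced actions of K are
   required to coincide ([lractK]). *)
Record bimodule (K : comPzRingType) (S R : algebra K) := Bimodule {
  bimodule_sort :> zmodType;
  lact : S -> bimodule_sort -> bimodule_sort;
  ract : bimodule_sort -> R -> bimodule_sort;
  lactDl : forall s t m, lact (s + t) m = lact s m + lact t m;
  lactDr : forall s m m', lact s (m + m') = lact s m + lact s m';
  lactA : forall s t m, lact s (lact t m) = lact (s * t) m;
  lact1 : forall m, lact 1 m = m;
  ractDl : forall m m' r, ract (m + m') r = ract m r + ract m' r;
  ractDr : forall m r r', ract m (r + r') = ract m r + ract m r';
  ractA : forall m r r', ract (ract m r) r' = ract m (r * r');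
  ract1 : forall m, ract m 1 = m;
  lractA : forall s m r, ract (lact s m) r = lact s (ract m r);
  lractK : forall (k : K) m, lact (alg_const k) m = ract m (alg_const k)
}.

Section Bimodules.
Variables (K : comPzRingType) (S R : algebra K).

Definition bimod_morphism (M N : bimodule S R) (f : M -> N) : Prop :=
  [/\ {morph f : x y / x + y},
      forall s m, f (lact s m) = lact s (f m) &
      forall m r, f (ract m r) = ract (f m) r].

Definition bimod_iso (M N : bimodule S R) : Prop :=
  exists f : M -> N, bimod_morphism f /\ bijective f.

Program Definition dsum (M N : bimodule S R) : bimodule S R :=
  @Bimodule K S R (M * N)%type
    (fun s p => (lact s p.1, lact s p.2)) (fun p r => (ract p.1 r, ract p.2 r))
    _ _ _ _ _ _ _ _ _ _.
Next Obligation. by move=> * /=; rewrite !lactDl. Qed.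
Next Obligation. by move=> * /=; rewrite !lactDr. Qed.
Next Obligation. by move=> * /=; rewrite !lactA. Qed.
Next Obligation. by move=> M N [m p] /=; rewrite !lact1. Qed.
Next Obligation. by move=> * /=; rewrite !ractDl. Qed.
Next Obligation. by move=> * /=; rewrite !ractDr. Qed.
Next Obligation. by move=> * /=; rewrite !ractA. Qed.
Next Obligation. by move=> M N [m p] /=; rewrite !ract1. Qed.
Next Obligation. by move=> * /=; rewrite !lractA. Qed.
Next Obligation. by move=> * /=; rewrite !lractK. Qed.

Program Definition bimod_pow (M : bimodule S R) (N : nat) : bimodule S R :=
  @Bimodule K S R {ffun 'I_N -> M}
    (fun s x => [ffun i => lact s (x i)]) (fun x r => [ffun i => ract (x i) r])
    _ _ _ _ _ _ _ _ _ _.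
Next Obligation. by move=> * /=; apply/ffunP => i; rewrite !ffunE lactDl. Qed.
Next Obligation. by move=> * /=; apply/ffunP => i; rewrite !ffunE lactDr. Qed.
Next Obligation. by move=> * /=; apply/ffunP => i; rewrite !ffunE lactA. Qed.
Next Obligation. by move=> * /=; apply/ffunP => i; rewrite !ffunE lact1. Qed.
Next Obligation. by move=> * /=; apply/ffunP => i; rewrite !ffunE ractDl. Qed.
Next Obligation. by move=> * /=; apply/ffunP => i; rewrite !ffunE ractDr. Qed.
Next Obligation. by move=> * /=; apply/ffunP => i; rewrite !ffunE ractA. Qed.
Next Obligation. by move=> * /=; apply/ffunP => i; rewrite !ffunE ract1. Qed.
Next Obligation. by move=> * /=; apply/ffunP => i; rewrite !ffunE lractA. Qed.
Next Obligation. by move=> * /=; apply/ffunP => i; rewrite !ffunE lractK. Qed.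

(* X (+) * ~= Y *)
Definition is_summand (X Y : bimodule S R) : Prop :=
  exists Z : bimodule S R, bimod_iso (dsum X Z) Y.

End Bimodules.

Program Definition regular_bimod (K : comPzRingType) (A : algebra K) :
    bimodule A A :=
  @Bimodule K A A A (fun a x => a * x) (fun x a => x * a)
    _ _ _ _ _ _ _ _ _ _.
Next Obligation. by move=> * /=; rewrite mulrDl. Qed.
Next Obligation. by move=> * /=; rewrite mulrDr. Qed.
Next Obligation. by move=> * /=; rewrite mulrA. Qed.
Next Obligation. by move=> * /=; rewrite mul1r. Qed.
Next Obligation. by move=> * /=; rewrite mulrDl. Qed.
Next Obligation. by move=> * /=; rewrite mulrDr. Qed.
Next Obligation. by move=> * /=; rewrite mulrA. Qed.
Next Obligation. by move=> * /=; rewrite mulr1. Qed.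
Next Obligation. by move=> * /=; rewrite mulrA. Qed.
Next Obligation. by move=> * /=; rewrite alg_constC. Qed.

Section Restriction.
Variables (K : comPzRingType) (S T R : algebra K).

Program Definition lrestrict (f : alg_morphism T S) (M : bimodule S R) :
    bimodule T R :=
  @Bimodule K T R M (fun t m => lact (f t) m) (fun m r => ract m r)
    _ _ _ _ _ _ _ _ _ _.
Next Obligation. by move=> * /=; rewrite rmorphD lactDl. Qed.
Next Obligation. by move=> * /=; rewrite lactDr. Qed.
Next Obligation. by move=> * /=; rewrite rmorphM lactA. Qed.
Next Obligation. by move=> * /=; rewrite rmorph1 lact1. Qed.
Next Obligation. by move=> * /=; rewrite ractDl. Qed.
Next Obligation. by move=> * /=; rewrite ractDr. Qed.
Next Obligation. by move=> * /=; rewrite ractA. Qed.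
Next Obligation. by move=> * /=; rewrite ract1. Qed.
Next Obligation. by move=> * /=; rewrite lractA. Qed.
Next Obligation. by move=> * /=; rewrite alg_morphism_const lractK. Qed.

Program Definition rrestrict (f : alg_morphism T R) (M : bimodule S R) :
    bimodule S T :=
  @Bimodule K S T M (fun s m => lact s m) (fun m t => ract m (f t))
    _ _ _ _ _ _ _ _ _ _.
Next Obligation. by move=> * /=; rewrite lactDl. Qed.
Next Obligation. by move=> * /=; rewrite lactDr. Qed.
Next Obligation. by move=> * /=; rewrite lactA. Qed.
Next Obligation. by move=> * /=; rewrite lact1. Qed.
Next Obligation. by move=> * /=; rewrite ractDl. Qed.
Next Obligation. by move=> * /=; rewrite rmorphD ractDr. Qed.
Next Obligation. by move=> * /=; rewrite rmorphM ractA. Qed.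
Next Obligation. by move=> * /=; rewrite rmorph1 ract1. Qed.
Next Obligation. by move=> * /=; rewrite lractA. Qed.
Next Obligation. by move=> * /=; rewrite alg_morphism_const lractK. Qed.

End Restriction.

Section Tensor.
Variables (K : comPzRingType) (S B R : algebra K).
Variables (M : bimodule S B) (N : bimodule B R).

Notation free := {freeg (M * N)%type / int}.

(* The subgroup of the free abelian group on M x N generated by the relations
   of biadditivity and B-balancedness. *)
Inductive tensor_rel : free -> Prop :=
| tensor_relDl m m' n :
    tensor_rel (<< (m + m', n) >> - << (m, n) >> - << (m', n) >>)
| tensor_relDr m n n' :
    tensor_rel (<< (m, n + n') >> - << (m, n) >> - << (m, n') >>)
| tensor_relA m b n :
    tensor_rel (<< (ract m b, n) >> - << (m, lact b n) >>)
| tensor_rel0 : tensor_rel 0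
| tensor_relB x y : tensor_rel x -> tensor_rel y -> tensor_rel (x - y).

Definition tensor_relb (x : free) : bool := `[< tensor_rel x >].

Fact tensor_relb_zmod_closed : zmod_closed tensor_relb.
Proof.
split=> [|x y /asboolP hx /asboolP hy]; apply/asboolP;
  [exact: tensor_rel0 | exact: tensor_relB].
Qed.

HB.instance Definition _ :=
  GRing.isZmodClosed.Build free tensor_relb tensor_relb_zmod_closed.

Definition relators : zmodClosed free :=
  GRing.ZmodClosed.clone free tensor_relb _.

Definition tensor : zmodType := quot relators.

Definition tmul (m : M) (n : N) : tensor := \pi_(quot relators) << (m, n) >>.

Definition balanced (V : zmodType) (f : M -> N -> V) : Prop :=
  [/\ forall m m' n, f (m + m') n = f m n + f m' n,
      forall m n n', f m (n + n') = f m n + f m n' &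
      forall m b n, f (ract m b) n = f m (lact b n)].

(* The additive map m (x) n |-> f m n; meaningful when f is balanced. *)
Definition tensor_lift (V : zmodType) (f : M -> N -> V) (x : tensor) : V :=
  fglift (fun p : M * N => f p.1 p.2 : zmodule V)
    (repr (x : quot relators)).

Lemma tmul_balanced : balanced tmul.
Proof.
split=> *; apply/eqP; rewrite /tmul -?pi_addr -idealrBE; apply/asboolP.
- by rewrite opprD addrA; apply: tensor_relDl.
- by rewrite opprD addrA; apply: tensor_relDr.
- exact: tensor_relA.
Qed.

Lemma tmulDl m m' n : tmul (m + m') n = tmul m n + tmul m' n.
Proof. by have [-> _ _] := tmul_balanced. Qed.

Lemma tmulDr m n n' : tmul m (n + n') = tmul m n + tmul m n'.
Proof. by have [_ -> _] := tmul_balanced. Qed.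

Lemma tmulA m b n : tmul (ract m b) n = tmul m (lact b n).
Proof. by have [_ _ ->] := tmul_balanced. Qed.

Section Lift.
Variables (V : zmodType) (f : M -> N -> V).
Hypothesis fB : balanced f.

Let g : free -> zmodule V := fglift (fun p : M * N => f p.1 p.2 : zmodule V).

Let gB x y : g (x - y) = g x - g y.
Proof. exact: lift_is_additive. Qed.

Let gU m n : g << (m, n) >> = f m n.
Proof. by rewrite /g liftU scale1r. Qed.

Let g_rel x : tensor_rel x -> g x = 0.
Proof.
have [fDl fDr fA] := fB.
elim=> {x} [m m' n|m n n'|m b n||x y _ gx _ gy].
- by rewrite !gB !gU fDl addrAC addrK subrr.
- by rewrite !gB !gU fDr addrAC addrK subrr.
- by rewrite gB !gU fA subrr.
- by rewrite -[0](subrr 0) gB subrr.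
- by rewrite gB gx gy subrr.
Qed.

Let lift_pi x : tensor_lift f (\pi_(quot relators) x) = g x.
Proof.
apply/eqP; rewrite -subr_eq0 -[tensor_lift _ _]/(g _) -gB; apply/eqP/g_rel.
by apply/asboolP; rewrite -/(tensor_relb _) -[tensor_relb _]/(_ \in relators) idealrBE reprK.
Qed.

Lemma tensor_lift_tmul m n : tensor_lift f (tmul m n) = f m n.
Proof. by rewrite lift_pi gU. Qed.

Lemma tensor_liftB : {morph tensor_lift f : x y / x - y}.
Proof.
move=> x y; rewrite -[x]reprK -[y]reprK -pi_oppr -pi_addr !lift_pi.
exact: gB.
Qed.

Lemma tensor_liftD : {morph tensor_lift f : x y / x + y}.
Proof.
have l0 : tensor_lift f 0 = 0 by rewrite -[0 in LHS](subrr 0) tensor_liftB subrr.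
by move=> x y; rewrite -[y in LHS]opprK -[- y]sub0r !tensor_liftB l0 sub0r opprK.
Qed.

End Lift.

Lemma tensor_ind (P : tensor -> Prop) :
    (forall m n, P (tmul m n)) -> (forall x y, P x -> P y -> P (x - y)) ->
  forall x, P x.
Proof.
move=> Pt PB x.
have P0 : P 0 by rewrite -(subrr (tmul 0 0)); apply: (PB).
have PD y z : P y -> P z -> P (y + z).
  by move=> Py Pz; rewrite -[z]opprK -[- z]sub0r; apply: (PB) => //; apply: PB.
rewrite -[x]reprK -[repr _]freeg_sumE.
elim: (dom _) => [|p s IH]; first by rewrite big_nil pi_zeror.
rewrite big_cons pi_addr; apply: (PD) => //; case: p => m n.
have PM j : P (\pi_(quot relators) << j%:R *g (m, n) >>).
  elim: j => [|j IHj]; first by rewrite freegU0 pi_zeror.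
  by rewrite -addn1 natrD -freegUD pi_addr; apply: (PD) => //; apply: Pt.
case: (coeff _ _) => j; first by rewrite -[Posz j]natz.
rewrite NegzE -natz -freegUN -[- _]sub0r pi_addr pi_oppr pi_zeror.
exact: PB.
Qed.

Let lfun s (m : M) (n : N) := tmul (lact s m) n.
Let rfun r (m : M) (n : N) := tmul m (ract n r).

Let lfunP s : balanced (lfun s).
Proof.
by split=> *; rewrite /lfun ?lactDr ?tmulDl ?tmulDr // -lractA tmulA.
Qed.

Let rfunP r : balanced (rfun r).
Proof.
by split=> *; rewrite /rfun ?ractDl ?tmulDl ?tmulDr // lractA tmulA.
Qed.

Definition tensor_lact s := tensor_lift (lfun s).
Definition tensor_ract x r := tensor_lift (rfun r) x.

Lemma tensor_lactE s m n : tensor_lact s (tmul m n) = tmul (lact s m) n.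
Proof. exact: tensor_lift_tmul. Qed.

Lemma tensor_ractE m n r : tensor_ract (tmul m n) r = tmul m (ract n r).
Proof. exact: (tensor_lift_tmul (rfunP r)). Qed.

Let lB s x y : tensor_lact s (x - y) = tensor_lact s x - tensor_lact s y.
Proof. exact: tensor_liftB. Qed.

Let rB x y r : tensor_ract (x - y) r = tensor_ract x r - tensor_ract y r.
Proof. exact: (tensor_liftB (rfunP r)). Qed.

Let tE := (tensor_lactE, tensor_ractE, lB, rB).

Program Definition tensor_bimod : bimodule S R :=
  @Bimodule K S R tensor tensor_lact tensor_ract _ _ _ _ _ _ _ _ _ _.
Next Obligation.
move=> s t; elim/tensor_ind => [m n|x y]; rewrite !tE ?lactDl ?tmulDl //.
by move=> -> ->; rewrite opprD addrACA.
Qed.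
Next Obligation. by move=> s; apply: tensor_liftD. Qed.
Next Obligation.
by move=> s t; elim/tensor_ind => [m n|x y]; rewrite !tE ?lactA // => -> ->.
Qed.
Next Obligation.
by elim/tensor_ind => [m n|x y]; rewrite !tE ?lact1 // => -> ->.
Qed.
Next Obligation. by move=> x y r; apply: (tensor_liftD (rfunP r)). Qed.
Next Obligation.
move=> x r r'; elim/tensor_ind: x => [m n|x y]; rewrite !tE ?ractDr ?tmulDr //.
by move=> -> ->; rewrite opprD addrACA.
Qed.
Next Obligation.
move=> x r r'; elim/tensor_ind: x => [m n|x y]; rewrite !tE ?ractA //.
by move=> -> ->.
Qed.
Next Obligation.
by elim/tensor_ind => [m n|x y]; rewrite !tE ?ract1 // => -> ->.
Qed.
Next Obligation.
by move=> s x r; elim/tensor_ind: x => [m n|x y]; rewrite !tE // => -> ->.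
Qed.
Next Obligation.
move=> k; elim/tensor_ind => [m n|x y]; rewrite !tE; last by move=> -> ->.
by rewrite lractK tmulA lractK.
Qed.

End Tensor.

Section D2.
Variables (K : comPzRingType) (B A : algebra K).
Variable iota : alg_morphism B A.

(* A (x)_B A, as an A-A-bimodule *)
Definition tensor_square : bimodule A A :=
  tensor_bimod (rrestrict iota (regular_bimod A))
               (lrestrict iota (regular_bimod A)).

Definition left_D2 : Prop :=
  exists N : nat, (0 < N)%N /\
    is_summand (lrestrict iota tensor_square)
               (bimod_pow (lrestrict iota (regular_bimod A)) N).

Definition right_D2 : Prop :=
  exists N : nat, (0 < N)%N /\
    is_summand (rrestrict iota tensor_square)
               (bimod_pow (rrestrict iota (regular_bimod A)) N).

Definition D2 : Prop := left_D2 /\ right_D2.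

End D2.

(* Main.v *)
Require Import Defs.
From mathcomp Require Import all_boot all_order all_algebra.
From mathcomp Require Import boolp.
From HB Require Import structures.

Set Implicit Arguments.
Unset Strict Implicit.
Unset Printing Implicit Defensive.

Import GRing.Theory.

Local Open Scope ring_scope.

(** Bimodules over product algebras split along the central idempotents e_k
    = (0, ..., 1, ..., 0). Write M ~ (+)_k M_k when an S-R-bimodule M, with
    S and R products of the S_k and R_k, is the direct sum of the
    S_k-R_k-bimodules M_k, regarded as S-R-bimodules through the
    projections of S and R ([biproduct]). The regular bimodule of a product
    algebra splits in this way ([regular_biproduct]), restriction of
    scalars along a product of morphisms respects the splitting
    ([lrestrict_biproduct], [rrestrict_biproduct]), and so does the tensor
    product ([tensor_biproduct]), because the cross terms M_k (x) N_l
    vanish for k <> l. Therefore A (x)_B A splits into the A_k (x)_(B_k)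
    A_k, compatibly with the splitting of A into the A_k, for the B-A- as
    well as for the A-B-bimodule structures.

    It remains to see that X is a direct summand of some power of Y if and
    only if each X_k is a direct summand of some power of Y_k, given X ~
    (+)_k X_k and Y ~ (+)_k Y_k. The first property says that the identity
    of X is a finite sum of endomorphisms factoring through Y
    ([summand_powP]); this removes the exponent and makes the property
    additive. A bimodule map X -> Y restricts to the components X_k -> Y_k,
    and since bimodule maps commute with e_k, a factorization of an
    endomorphism of X through Y restricts as well; in the other direction,
    maps X_k -> Y_k extend by zero, and the identity of X is the sum of the
    extensions of the identities of the X_k ([sum_through_biproduct]). *)

#[local] Obligation Tactic := idtac.

(** * Bimodule morphisms *)

Section Morphisms.
Variables (K : comPzRingType) (S R : algebra K).
Implicit Types X Y Z : bimodule S R.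

Lemma bimod_morph0 X Y (f : X -> Y) : bimod_morphism f -> f 0 = 0.
Proof. by case=> fD _ _; apply: (addrI (f 0)); rewrite -fD !addr0. Qed.

Lemma bimod_morphN X Y (f : X -> Y) : bimod_morphism f -> {morph f : x / - x}.
Proof.
move=> fM x; apply: (addrI (f x)); case: (fM) => fD _ _.
by rewrite -fD !subrr (bimod_morph0 fM).
Qed.

Lemma bimod_morph_sum X Y (f : X -> Y) I (r : seq I) (F : I -> X) :
  bimod_morphism f -> f (\sum_(i <- r) F i) = \sum_(i <- r) f (F i).
Proof.
by move=> fM; case: (fM) => fD _ _; apply: (big_morph f fD (bimod_morph0 fM)).
Qed.

Lemma lact0r X (s : S) : lact s (0 : X) = 0.
Proof. by apply: (addrI (lact s 0)); rewrite -lactDr !addr0. Qed.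

Lemma lact0l X (m : X) : lact (0 : S) m = 0.
Proof. by apply: (addrI (lact 0 m)); rewrite -lactDl !addr0. Qed.

Lemma ract0l X (r : R) : ract (0 : X) r = 0.
Proof. by apply: (addrI (ract 0 r)); rewrite -ractDl !addr0. Qed.

Lemma ract0r X (m : X) : ract m (0 : R) = 0.
Proof. by apply: (addrI (ract m 0)); rewrite -ractDr !addr0. Qed.

Lemma lactBr X (s : S) (m m' : X) : lact s (m - m') = lact s m - lact s m'.
Proof.
rewrite lactDr; congr (_ + _); apply: (addrI (lact s m')).
by rewrite -lactDr !subrr lact0r.
Qed.

Lemma ractBl X (m m' : X) (r : R) : ract (m - m') r = ract m r - ract m' r.
Proof.
rewrite ractDl; congr (_ + _); apply: (addrI (ract m' r)).
by rewrite -ractDl !subrr ract0l.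
Qed.

Lemma bimod_morph_comp X Y Z (f : X -> Y) (g : Y -> Z) :
  bimod_morphism f -> bimod_morphism g -> bimod_morphism (g \o f).
Proof.
case=> fD fl fr [gD gl gr].
by split=> [x y|s x|x r] /=; rewrite ?(fD, fl, fr) ?(gD, gl, gr).
Qed.

End Morphisms.

(** * Direct summands as retracts *)

Section Kernel.
Variables (K : comPzRingType) (S R : algebra K) (X Y : bimodule S R).
Variables (g : Y -> X) (gM : bimod_morphism g).

(** The proof that [g] is a morphism is an argument, so that the closure
    properties of the kernel, which depend on it, can be inferred from the
    predicate and from the type [kernel] below. *)
Definition in_kernel (_ : bimod_morphism g) (y : Y) : bool := g y == 0.

Fact in_kernel_zmod_closed : zmod_closed (in_kernel gM).
Proof.
split=> [|x y /eqP gx /eqP gy]; apply/eqP; first exact: bimod_morph0 gM.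
by case: (gM) => gD _ _; rewrite gD (bimod_morphN gM) gx gy subrr.
Qed.

HB.instance Definition _ :=
  GRing.isZmodClosed.Build Y (in_kernel gM) in_kernel_zmod_closed.

Definition kernel : Type := {y : Y | in_kernel gM y}.

HB.instance Definition _ := SubChoice.on kernel.
HB.instance Definition _ := [SubChoice_isSubZmodule of kernel by <:].

Fact kernel_valD (x y : kernel) : val (x + y) = val x + val y.
Proof. exact: raddfD. Qed.

Fact in_kernel_lact s (z : kernel) : in_kernel gM (lact s (val z)).
Proof.
have [_ gl _] := gM; have /eqP gz := valP z.
by rewrite /in_kernel gl gz lact0r.
Qed.

Fact in_kernel_ract (z : kernel) r : in_kernel gM (ract (val z) r).
Proof.
have [_ _ gr] := gM; have /eqP gz := valP z.
by rewrite /in_kernel gr gz ract0l.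
Qed.

Program Definition kernel_bimod : bimodule S R :=
  @Bimodule K S R kernel
    (fun s z => Sub _ (in_kernel_lact s z))
    (fun z r => Sub _ (in_kernel_ract z r))
    _ _ _ _ _ _ _ _ _ _.
Next Obligation.
by move=> *; apply: val_inj; rewrite !(SubK, kernel_valD) lactDl.
Qed.
Next Obligation.
by move=> *; apply: val_inj; rewrite !(SubK, kernel_valD) lactDr.
Qed.
Next Obligation. by move=> *; apply: val_inj; rewrite !SubK lactA. Qed.
Next Obligation. by move=> *; apply: val_inj; rewrite !SubK lact1. Qed.
Next Obligation.
by move=> *; apply: val_inj; rewrite !(SubK, kernel_valD) ractDl.
Qed.
Next Obligation.
by move=> *; apply: val_inj; rewrite !(SubK, kernel_valD) ractDr.
Qed.
Next Obligation. by move=> *; apply: val_inj; rewrite !SubK ractA. Qed.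
Next Obligation. by move=> *; apply: val_inj; rewrite !SubK ract1. Qed.
Next Obligation. by move=> *; apply: val_inj; rewrite !SubK lractA. Qed.
Next Obligation. by move=> *; apply: val_inj; rewrite !SubK lractK. Qed.

Definition kernel_incl (z : kernel_bimod) : Y := val z.

Lemma kernel_inclM : bimod_morphism kernel_incl.
Proof. by split=> *; rewrite /kernel_incl ?kernel_valD ?SubK. Qed.

End Kernel.

(** The complement of a retract f : X -> Y with retraction g is the kernel of
    g: every y is the sum of f (g y) and y - f (g y). *)
Lemma summandP (K : comPzRingType) (S R : algebra K) (X Y : bimodule S R) :
  is_summand X Y <-> exists (f : X -> Y) (g : Y -> X),
    [/\ bimod_morphism f, bimod_morphism g & cancel f g].
Proof.
split=> [[Z [h [[hD hl hr] [h' hK h'K]]]]|[f [g [fM gM fK]]]].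
  exists (fun x => h (x, 0)), (fun y => (h' y).1); split.
  - split=> [x y|s x|x r]; rewrite -?hD -?hl -?hr; congr h.
    + by congr pair; rewrite addr0.
    + by congr pair; rewrite lact0r.
    + by congr pair; rewrite ract0l.
  - split=> [x y|s x|x r].
    + by rewrite -{1}[x]h'K -{1}[y]h'K -hD hK.
    + by rewrite -{1}[x]h'K -hl hK.
    + by rewrite -{1}[x]h'K -hr hK.
  - by move=> x; rewrite hK.
case: (fM) (gM) => fD fl fr [gD gl gr].
have [zD zl zr] := kernel_inclM gM.
have res_ker y : in_kernel gM (y - f (g y)).
  by rewrite /in_kernel gD (bimod_morphN gM) fK subrr.
have gZ (z : kernel_bimod gM) : g (kernel_incl z) = 0.
  by apply/eqP; apply: (valP z).
exists (kernel_bimod gM), (fun p => f p.1 + kernel_incl p.2); split.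
  split=> [[x z] [x' z']|s [x z]|[x z] r].
  - by rewrite [f _]fD [kernel_incl _]zD addrACA.
  - by rewrite [f _]fl [kernel_incl _]zl lactDr.
  - by rewrite [f _]fr [kernel_incl _]zr ractDl.
exists (fun y => (g y, Sub _ (res_ker y) : kernel_bimod gM)) => [[x z]|y] /=.
  congr pair; first by rewrite gD fK gZ addr0.
  by apply: val_inj; rewrite SubK gD fK gZ addr0 addrAC subrr add0r.
by rewrite /kernel_incl SubK addrC subrK.
Qed.

(** * Summands of powers and factorizations of the identity *)

Section Factoring.
Variables (K : comPzRingType) (S R : algebra K) (X Y : bimodule S R).

(** The endomorphisms that are finite sums of composites X -> Y -> X.  The
    inductive form, without the number of terms, makes transport along any
    additive operation on endomorphisms a plain induction. *)
Inductive sum_through : (X -> X) -> Prop :=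
| sum_through0 : sum_through (fun=> 0)
| sum_throughS (f : X -> Y) (g : Y -> X) (h : X -> X) :
    bimod_morphism f -> bimod_morphism g -> sum_through h ->
  sum_through (fun x => g (f x) + h x).

Lemma sum_throughD h h' :
  sum_through h -> sum_through h' -> sum_through (fun x => h x + h' x).
Proof.
move=> Hh Hh'; elim: Hh => [|f g k fM gM _ IH].
  by under eq_fun do rewrite add0r.
by under eq_fun do rewrite -addrA; apply: sum_throughS.
Qed.

Lemma sum_through_sum I (r : seq I) (h : I -> X -> X) :
    (forall i, sum_through (h i)) ->
  sum_through (fun x => \sum_(i <- r) h i x).
Proof.
move=> Hh; elim: r => [|i r IH].
  by under eq_fun do rewrite big_nil; apply: sum_through0.
by under eq_fun do rewrite big_cons; apply: sum_throughD.
Qed.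

Lemma sum_through_comp (f : X -> Y) (g : Y -> X) :
  bimod_morphism f -> bimod_morphism g -> sum_through (fun x => g (f x)).
Proof.
move=> fM gM; have := sum_throughS fM gM sum_through0.
by under eq_fun do rewrite addr0.
Qed.

(** The terms of the sum become the coordinates of maps to and from a power
    of Y.  The exponent is one more than the number of terms, so that it is
    positive even for the empty sum. *)
Lemma sum_through_pow h : sum_through h ->
  exists N, exists (F : X -> bimod_pow Y N.+1) (G : bimod_pow Y N.+1 -> X),
    [/\ bimod_morphism F, bimod_morphism G & forall x, G (F x) = h x].
Proof.
elim=> [|f g k fM gM _ [N [F [G [FM GM GF]]]]].
  exists 0%N, (fun=> 0), (fun=> 0); split=> //.
    by split=> [x y|s x|x r]; rewrite (addr0, lact0r, ract0l).
  by split=> [x y|s x|x r]; rewrite (addr0, lact0r, ract0l).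
case: (fM) (gM) (FM) (GM) => fD fl fr [gD gl gr] [FD Fl Fr] [GD Gl Gr].
pose tail (y : bimod_pow Y N.+2) : bimod_pow Y N.+1 :=
  [ffun j => y (lift ord0 j)].
exists N.+1.
exists (fun x => [ffun i => oapp (fun j => F x j) (f x) (unlift ord0 i)]).
exists (fun y : bimod_pow Y N.+2 => g (y ord0) + G (tail y)); split.
- split=> [x y|s x|x r]; apply/ffunP => i; rewrite !ffunE;
    by case: unliftP => [j|] _ /=; rewrite ?FD ?Fl ?Fr ?ffunE // ?fD ?fl ?fr.
- split=> [x y|s x|x r].
  + have -> : tail (x + y) = tail x + tail y.
      by apply/ffunP => j; rewrite !ffunE.
    by rewrite ffunE gD GD addrACA.
  + have -> : tail (lact s x) = lact s (tail x).
      by apply/ffunP => j; rewrite !ffunE.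
    by rewrite ffunE gl Gl lactDr.
  + have -> : tail (ract x r) = ract (tail x) r.
      by apply/ffunP => j; rewrite !ffunE.
    by rewrite ffunE gr Gr ractDl.
- move=> x; rewrite ffunE unlift_none /= -GF; congr (_ + G _).
  by apply/ffunP => j; rewrite !ffunE liftK.
Qed.

(** A retraction of X from Y^N is the same as a decomposition of the identity
    of X into the N composites through the coordinates of Y^N. *)
Lemma summand_powP :
  (exists N, (0 < N)%N /\ is_summand X (bimod_pow Y N)) <-> sum_through id.
Proof.
split=> [[N [_ /summandP[f [g [fM gM fK]]]]]|/sum_through_pow].
  pose single i (y : Y) : bimod_pow Y N := [ffun j => if j == i then y else 0].
  have singleM i : bimod_morphism (single i).
    split=> [x y|s x|x r]; apply/ffunP => j; rewrite !ffunE;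
      by case: eqP; rewrite ?addr0 ?lact0r ?ract0l.
  have evalM (i : 'I_N) : bimod_morphism (fun x => f x i).
    by case: fM => fD fl fr; split=> [x y|s x|x r]; rewrite (fD, fl, fr) ffunE.
  have -> : id = (fun x => \sum_(i <- enum 'I_N) g (single i (f x i))).
    apply/funext => x; rewrite -bimod_morph_sum // -{1}[x]fK; congr g.
    apply/ffunP => j; rewrite big_enum /= sum_ffunE (bigD1 j) //= ffunE eqxx.
    by rewrite big1 ?addr0 // => i /negPf ij; rewrite ffunE eq_sym ij.
  apply: sum_through_sum => i.
  exact: (sum_through_comp (evalM i) (bimod_morph_comp (singleM i) gM)).
case=> N [F [G [FM GM GF]]]; exists N.+1; split=> //.
by apply/summandP; exists F, G; split.
Qed.

End Factoring.

(** * Projections of a product algebra *)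

Section Projection.
Variables (K : comPzRingType) (n : nat) (A : 'I_n -> algebra K).
Implicit Types x y : prodAlg A.

Lemma prodAlgDE x y k : (x + y) k = x k + y k. Proof. exact: ffunE. Qed.
Lemma prodAlgNE x k : (- x) k = - x k. Proof. exact: ffunE. Qed.
Lemma prodAlgME x y k : (x * y) k = x k * y k. Proof. exact: ffunE. Qed.
Lemma prodAlg1E k : (1 : prodAlg A) k = 1. Proof. exact: ffunE. Qed.

Definition prodAlg_eval k x : A k := x k.

Fact prodAlg_eval_zmod_morphism k : zmod_morphism (prodAlg_eval k).
Proof. by move=> x y; rewrite /prodAlg_eval prodAlgDE prodAlgNE. Qed.
Fact prodAlg_eval_monoid_morphism k : monoid_morphism (prodAlg_eval k).
Proof.
by split=> [|x y]; rewrite /prodAlg_eval ?prodAlg1E ?prodAlgME.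
Qed.

HB.instance Definition _ k := GRing.isZmodMorphism.Build _ _ (prodAlg_eval k)
  (prodAlg_eval_zmod_morphism k).
HB.instance Definition _ k := GRing.isMonoidMorphism.Build _ _ (prodAlg_eval k)
  (prodAlg_eval_monoid_morphism k).

Fact prodAlg_eval_const k (c : K) : prodAlg_eval k (alg_const c) = alg_const c.
Proof. by rewrite /prodAlg_eval /= ffunE. Qed.

Definition prodAlg_proj k : alg_morphism (prodAlg A) (A k) :=
  @AlgMorphism K (prodAlg A) (A k) (prodAlg_eval k) (prodAlg_eval_const k).

Definition prodAlg_single k (a : A k) : prodAlg A :=
  [ffun l => dfwith (fun l => 0 : A l) a l : A l].

Lemma prodAlg_singleK k (a : A k) : prodAlg_single a k = a.
Proof. by rewrite ffunE dfwith_in. Qed.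

Lemma prodAlg_single_neq k l (a : A k) : k != l -> prodAlg_single a l = 0.
Proof. by move=> kl; rewrite ffunE dfwith_out. Qed.

End Projection.

(** * Bimodules over product algebras *)

Section Biproduct.
Variables (K : comPzRingType) (n : nat) (S R : 'I_n -> algebra K).

Definition inflate k (M : bimodule (S k) (R k)) :
    bimodule (prodAlg S) (prodAlg R) :=
  lrestrict (prodAlg_proj S k) (rrestrict (prodAlg_proj R k) M).

(** The isomorphism of M with the direct sum of the [Mk k] in terms of
    projections and injections, which can be carried through restrictions and
    tensor products one index at a time.  That distinct components are
    orthogonal follows from bilinearity over the idempotents of the
    product algebras. *)
Record biproduct (M : bimodule (prodAlg S) (prodAlg R))
    (Mk : forall k, bimodule (S k) (R k)) := Biproduct {
  bproj : forall k, M -> inflate (Mk k);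
  binj : forall k, inflate (Mk k) -> M;
  bprojM : forall k, bimod_morphism (bproj k);
  binjM : forall k, bimod_morphism (@binj k);
  binjK : forall k, cancel (@binj k) (bproj k);
  bproj_sum : forall m, \sum_k binj (bproj k m) = m
}.

Section Theory.
Variables (M : bimodule (prodAlg S) (prodAlg R)).
Variables (Mk : forall k, bimodule (S k) (R k)) (P : biproduct M Mk).

Lemma bprojl k s m :
  bproj P k (lact s m) = lact (s k : S k) (bproj P k m : Mk k).
Proof. by case: (bprojM P k) => _ -> _. Qed.

Lemma bprojr k m r :
  bproj P k (ract m r) = ract (bproj P k m : Mk k) (r k : R k).
Proof. by case: (bprojM P k) => _ _ ->. Qed.

(** The injections are linear over the product algebra, which acts on the
    component through its k-th coordinate; here a scalar of the k-th factor is
    lifted to the product, to make them semilinear over the factor. *)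
Lemma binjl k (s : S k) (m : Mk k) :
  binj P (lact s m : Mk k) = lact (prodAlg_single s) (binj P m).
Proof.
case: (binjM P k) => _ fl _; rewrite -fl /= /prodAlg_eval.
by rewrite prodAlg_singleK.
Qed.

Lemma binjr k (m : Mk k) (r : R k) :
  binj P (ract m r : Mk k) = ract (binj P m) (prodAlg_single r).
Proof.
case: (binjM P k) => _ _ fr; rewrite -fr /= /prodAlg_eval.
by rewrite prodAlg_singleK.
Qed.

(** The projector onto the k-th component is the action of the central
    idempotent e_k, and thus commutes with every bimodule morphism: e_k acts
    on the l-th component as its l-th coordinate, which is 1 for l = k and 0
    otherwise. *)
Lemma binj_bproj_lact k m :
  binj P (bproj P k m) = lact (prodAlg_single (1 : S k)) m.
Proof.
rewrite -[RHS](bproj_sum P) (bigD1 k) //= big1 => [|l lk].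
  by rewrite bprojl prodAlg_singleK lact1 addr0.
rewrite bprojl prodAlg_single_neq 1?eq_sym // lact0l.
exact: (bimod_morph0 (binjM P l)).
Qed.

Lemma binj_bproj_ract k m :
  binj P (bproj P k m) = ract m (prodAlg_single (1 : R k)).
Proof.
rewrite -[RHS](bproj_sum P) (bigD1 k) //= big1 => [|l lk].
  by rewrite bprojr prodAlg_singleK ract1 addr0.
rewrite bprojr prodAlg_single_neq 1?eq_sym // ract0r.
exact: (bimod_morph0 (binjM P l)).
Qed.

End Theory.

Section Maps.
Variables (X Y : bimodule (prodAlg S) (prodAlg R)).
Variables (Xk Yk : forall k, bimodule (S k) (R k)).
Variables (PX : biproduct X Xk) (PY : biproduct Y Yk).

Lemma bimod_morph_component k (f : X -> Y) : bimod_morphism f ->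
  bimod_morphism (fun x : Xk k => bproj PY k (f (binj PX x)) : Yk k).
Proof.
case=> fD fl fr; have [pD _ _] := bprojM PY k; have [iD _ _] := binjM PX k.
split=> [x y|s x|x r].
- by rewrite [binj _ _]iD fD [LHS]pD.
- by rewrite binjl fl bprojl prodAlg_singleK.
- by rewrite binjr fr bprojr prodAlg_singleK.
Qed.

Lemma bimod_morph_extend k (f : Xk k -> Yk k) : bimod_morphism f ->
  bimod_morphism (fun x => binj PY (f (bproj PX k x))).
Proof.
case=> fD fl fr; have [pD pl pr] := bprojM PX k; have [iD il ir] := binjM PY k.
split=> [x y|s x|x r].
- by rewrite pD fD [LHS]iD.
- by rewrite bprojl fl -il.
- by rewrite bprojr fr -ir.
Qed.

End Maps.

Section Factoring.
Variables (X Y : bimodule (prodAlg S) (prodAlg R)).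
Variables (Xk Yk : forall k, bimodule (S k) (R k)).
Variables (PX : biproduct X Xk) (PY : biproduct Y Yk).

(** The composite of the k-th components of f : X -> Y and g : Y -> X is the
    k-th component of g \o f: the projector of Y which appears between them is
    the action of e_k, which g carries over to X, where the projection to the
    component absorbs it. *)
Lemma sum_through_component k (h : X -> X) : sum_through Y h ->
  sum_through (Yk k) (fun x : Xk k => bproj PX k (h (binj PX x)) : Xk k).
Proof.
have [pD _ _] := bprojM PX k.
elim=> [|f g h' fM gM _ IH].
  have -> : (fun x : Xk k => bproj PX k 0 : Xk k) = fun=> 0.
    by apply/funext => x; apply: bimod_morph0 (bprojM PX k).
  exact: sum_through0.
have := sum_throughS (bimod_morph_component PX PY k fM)
                     (bimod_morph_component PY PX k gM) IH.
congr sum_through; apply/funext => x; have [_ gl _] := gM.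
by rewrite binj_bproj_lact gl bprojl prodAlg_singleK lact1 [RHS]pD.
Qed.

Lemma sum_through_extend k (h : Xk k -> Xk k) : sum_through (Yk k) h ->
  sum_through Y (fun x => binj PX (h (bproj PX k x))).
Proof.
have [iD _ _] := binjM PX k.
elim=> [|f g h' fM gM _ IH].
  have -> : (fun x : X => binj PX (0 : Xk k)) = fun=> 0.
    by apply/funext => x; apply: bimod_morph0 (binjM PX k).
  exact: sum_through0.
have := sum_throughS (bimod_morph_extend PX PY fM)
                     (bimod_morph_extend PY PX gM) IH.
by congr sum_through; apply/funext => x; rewrite binjK -iD.
Qed.

Lemma sum_through_biproduct :
  sum_through Y (@id X) <-> forall k, sum_through (Yk k) (@id (Xk k)).
Proof.
split=> [H k|H].
  have := sum_through_component k H.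
  by congr sum_through; apply/funext => x; apply: binjK.
have -> : @id X = (fun x => \sum_(k <- enum 'I_n) binj PX (bproj PX k x)).
  by apply/funext => x; rewrite big_enum bproj_sum.
by apply: sum_through_sum => k; apply: sum_through_extend (H k).
Qed.

Lemma summand_pow_biproduct :
  (exists N, (0 < N)%N /\ is_summand X (bimod_pow Y N)) <->
  forall k, exists N, (0 < N)%N /\ is_summand (Xk k) (bimod_pow (Yk k) N).
Proof.
split=> [/summand_powP/sum_through_biproduct H k|H]; first exact/summand_powP.
by apply/summand_powP/sum_through_biproduct => k; apply/summand_powP.
Qed.

End Factoring.

End Biproduct.

(** * Regular, restricted and tensor product bimodules *)

Section Constructions.
Variables (K : comPzRingType) (n : nat).

Lemma prodAlg_sumE (A : 'I_n -> algebra K) I (r : seq I) (F : I -> prodAlg A)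
    l :
  (\sum_(i <- r) F i) l = \sum_(i <- r) F i l.
Proof. exact: (raddf_sum (prodAlg_eval l)). Qed.

Lemma regular_biproduct (A : 'I_n -> algebra K) :
  biproduct (regular_bimod (prodAlg A)) (fun k => regular_bimod (A k)).
Proof.
exists (fun k (x : prodAlg A) => x k) (fun k (a : A k) => prodAlg_single a).
- move=> k; split=> [x y|s x|x r]; [exact: prodAlgDE|exact: prodAlgME|].
  exact: prodAlgME.
- move=> k; split=> [x y|s x|x r]; apply/ffunP => l;
    rewrite [RHS](prodAlgDE, prodAlgME);
    have [<-|kl] := eqVneq k l;
    by rewrite ?prodAlg_singleK ?prodAlg_single_neq ?addr0 ?mulr0 ?mul0r.
- by move=> k a; rewrite prodAlg_singleK.
- move=> x; apply/ffunP => l; rewrite prodAlg_sumE (bigD1 l) //=.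
  rewrite prodAlg_singleK big1 ?addr0 // => k kl.
  by rewrite prodAlg_single_neq.
Qed.

Lemma lrestrict_biproduct (S T R : 'I_n -> algebra K)
    (f : forall k, alg_morphism (T k) (S k)) M Mk :
  @biproduct K n S R M Mk ->
  biproduct (lrestrict (prodAlg_morphism f) M)
            (fun k => lrestrict (f k) (Mk k)).
Proof.
move=> P; refine (@Biproduct _ _ _ _ (lrestrict (prodAlg_morphism f) M)
  (fun k => lrestrict (f k) (Mk k))
  (@bproj _ _ _ _ _ _ P) (@binj _ _ _ _ _ _ P) _ _ _ _).
- move=> k; have [pD pl pr] := bprojM P k; split=> // s m.
  by rewrite bprojl /= ffunE.
- move=> k; have [iD il ir] := binjM P k; split=> // s m.
  by rewrite /= -il /= /prodAlg_eval ffunE.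
- exact: (binjK P).
- exact: (bproj_sum P).
Qed.

Lemma rrestrict_biproduct (S T R : 'I_n -> algebra K)
    (f : forall k, alg_morphism (T k) (R k)) M Mk :
  @biproduct K n S R M Mk ->
  biproduct (rrestrict (prodAlg_morphism f) M)
            (fun k => rrestrict (f k) (Mk k)).
Proof.
move=> P; refine (@Biproduct _ _ _ _ (rrestrict (prodAlg_morphism f) M)
  (fun k => rrestrict (f k) (Mk k))
  (@bproj _ _ _ _ _ _ P) (@binj _ _ _ _ _ _ P) _ _ _ _).
- move=> k; have [pD pl pr] := bprojM P k; split=> // m r.
  by rewrite bprojr /= ffunE.
- move=> k; have [iD il ir] := binjM P k; split=> // m r.
  by rewrite /= -ir /= /prodAlg_eval ffunE.
- exact: (binjK P).
- exact: (bproj_sum P).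
Qed.

Lemma tensor_liftM (S B R : algebra K) (M : bimodule S B)
    (N : bimodule B R) (V : bimodule S R)
    (f : M -> N -> V) : balanced f ->
    (forall s m n, f (lact s m) n = lact s (f m n)) ->
    (forall m n r, f m (ract n r) = ract (f m n) r) ->
  bimod_morphism (tensor_lift f : tensor_bimod M N -> V).
Proof.
move=> fB fl fr; split; first exact: tensor_liftD.
- move=> s; elim/tensor_ind => [m n'|x y Hx Hy].
    by rewrite [lact _ _]tensor_lactE !tensor_lift_tmul.
  by rewrite lactBr !(tensor_liftB fB) lactBr Hx Hy.
- move=> x r; elim/tensor_ind: x => [m n'|x y Hx Hy].
    by rewrite [ract _ _]tensor_ractE !tensor_lift_tmul.
  by rewrite ractBl !(tensor_liftB fB) ractBl Hx Hy.
Qed.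

Lemma tmul_sumr (S B R : algebra K) (M : bimodule S B) (N : bimodule B R)
    I (r : seq I) (m : M) (F : I -> N) :
  tmul m (\sum_(i <- r) F i) = \sum_(i <- r) tmul m (F i).
Proof.
apply: (big_morph (tmul m) (tmulDr m)).
by apply: (addrI (tmul m 0)); rewrite -tmulDr !addr0.
Qed.

Section TensorBiproduct.
Variables (S B R : 'I_n -> algebra K).
Variables (M : bimodule (prodAlg S) (prodAlg B)).
Variables (N : bimodule (prodAlg B) (prodAlg R)).
Variables (Mk : forall k, bimodule (S k) (B k)).
Variables (Nk : forall k, bimodule (B k) (R k)).
Variables (PM : biproduct M Mk) (PN : biproduct N Nk).

Let proj_tmul k (m : M) (n : N) : tensor (Mk k) (Nk k) :=
  tmul (bproj PM k m : Mk k) (bproj PN k n : Nk k).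
Let inj_tmul k (m : Mk k) (n : Nk k) : tensor M N :=
  tmul (binj PM m) (binj PN n).

Let proj_tmulB k : balanced (@proj_tmul k).
Proof.
have [mD _ _] := bprojM PM k; have [nD _ _] := bprojM PN k.
split=> *; rewrite /proj_tmul.
- by rewrite [bproj _ _ _]mD; apply: tmulDl.
- by rewrite [bproj _ _ (_ + _)]nD; apply: tmulDr.
- by rewrite bprojr bprojl tmulA.
Qed.

Let inj_tmulB k : balanced (@inj_tmul k).
Proof.
have [mD _ _] := binjM PM k; have [nD _ _] := binjM PN k.
split=> *; rewrite /inj_tmul.
- by rewrite [binj _ _]mD; apply: tmulDl.
- by rewrite [binj _ (_ + _)]nD; apply: tmulDr.
- by rewrite binjr binjl tmulA.
Qed.

Let tproj k : tensor_bimod M N -> tensor_bimod (Mk k) (Nk k) :=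
  tensor_lift (@proj_tmul k).
Let tinj k : tensor_bimod (Mk k) (Nk k) -> tensor_bimod M N :=
  tensor_lift (@inj_tmul k).

Let tprojM k :
  bimod_morphism (@tproj k : _ -> inflate (tensor_bimod (Mk k) (Nk k))).
Proof.
apply: tensor_liftM => [|s m n'|m n' r]; first exact: proj_tmulB.
- by rewrite /proj_tmul bprojl [RHS]tensor_lactE.
- by rewrite /proj_tmul bprojr [RHS]tensor_ractE.
Qed.

Let tinjM k :
  bimod_morphism (@tinj k : inflate (tensor_bimod (Mk k) (Nk k)) -> _).
Proof.
have [_ il _] := binjM PM k; have [_ _ ir] := binjM PN k.
have IB : {morph @tinj k : x y / x - y} := tensor_liftB (@inj_tmulB k).
split; first exact: (tensor_liftD (@inj_tmulB k)).
- move=> s; elim/tensor_ind => [m n'|x y Hx Hy].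
    rewrite [lact _ _]tensor_lactE /tinj !(tensor_lift_tmul (@inj_tmulB k)).
    by rewrite /inj_tmul [binj _ _]il [RHS]tensor_lactE.
  by rewrite lactBr !IB lactBr Hx Hy.
- move=> x r; elim/tensor_ind: x => [m n'|x y Hx Hy].
    rewrite [ract _ _]tensor_ractE /tinj !(tensor_lift_tmul (@inj_tmulB k)).
    by rewrite /inj_tmul [binj _ (ract _ _)]ir [RHS]tensor_ractE.
  by rewrite ractBl !IB ractBl Hx Hy.
Qed.

(** Only the diagonal terms e_k (x) e_k survive in M (x) N: for k <> l the
    product of the orthogonal idempotents e_k and e_l of the middle algebra B
    vanishes, and with it M e_k (x) e_l N. *)
Lemma tensor_biproduct :
  biproduct (tensor_bimod M N) (fun k => tensor_bimod (Mk k) (Nk k)).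
Proof.
have PB k : {morph @tproj k : x y / x - y} := tensor_liftB (@proj_tmulB k).
have IB k : {morph @tinj k : x y / x - y} := tensor_liftB (@inj_tmulB k).
have PE k m n' : @tproj k (tmul m n') = proj_tmul k m n' :=
  tensor_lift_tmul (@proj_tmulB k) m n'.
have IE k m n' : @tinj k (tmul m n') = inj_tmul m n' :=
  tensor_lift_tmul (@inj_tmulB k) m n'.
refine (@Biproduct _ _ _ _ (tensor_bimod M N)
  (fun k => tensor_bimod (Mk k) (Nk k)) tproj tinj tprojM tinjM _ _) => [k|].
  elim/tensor_ind => [m n'|x y Hx Hy]; last by rewrite IB PB Hx Hy.
  by rewrite IE PE /proj_tmul !binjK.
elim/tensor_ind => [m n'|x y Hx Hy].
  (* m e_k (x) e_k n' = m (x) e_k n', since the idempotent e_k of B crosses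
     the tensor sign; the terms m (x) e_k n' add up to m (x) n'. *)
  under eq_bigr => k _ do
    rewrite PE IE /inj_tmul (binj_bproj_ract PM) tmulA -binjl lact1.
  by rewrite -tmul_sumr bproj_sum.
rewrite -{2}Hx -{2}Hy -sumrB; apply: eq_bigr => k _.
by rewrite PB IB.
Qed.

End TensorBiproduct.

Lemma tensor_square_biproduct (B A : 'I_n -> algebra K)
    (iota : forall k, alg_morphism (B k) (A k)) :
  biproduct (tensor_square (prodAlg_morphism iota))
            (fun k => tensor_square (iota k)).
Proof.
apply: tensor_biproduct.
- exact: (rrestrict_biproduct iota (regular_biproduct A)).
- exact: (lrestrict_biproduct iota (regular_biproduct A)).
Qed.

End Constructions.

Theorem proposition3p4 (K : comPzRingType) (n : nat)
    (B A : 'I_n -> algebra K) (iota : forall k, alg_morphism (B k) (A k)) :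
  D2 (prodAlg_morphism iota) <-> forall k : 'I_n, D2 (iota k).
Proof.
have regA := regular_biproduct A.
have sqA := tensor_square_biproduct iota.
have left_prod := summand_pow_biproduct (lrestrict_biproduct iota sqA)
                                        (lrestrict_biproduct iota regA).
have right_prod := summand_pow_biproduct (rrestrict_biproduct iota sqA)
                                         (rrestrict_biproduct iota regA).
split=> [[/left_prod L /right_prod R] k|D2k]; first by split.
by split; [apply/left_prod|apply/right_prod] => k; case: (D2k k).
Qed.
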